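(* Suppose the discrete Hamiltonian $H^+_d$ is almost surely continuously differentiable, and the discrete forces $F^\pm_d$ are almost surely continuous, with respect to their arguments $(q,p)$. A discrete random curve $\{(q_k,p_k)\}_{k=0,\ldots,K}\in C_d$ satisfies the set of equations $$q_k=D_2H^+_d(q_{k-1},p_k;t_{k-1},t_k)-F^+_d(q_{k-1},p_k;t_{k-1},t_k),$$ $$p_k=D_1H^+_d(q_k,p_{k+1};t_k,t_{k+1})-F^-_d(q_k,p_{k+1};t_k,t_{k+1}),$$ almost surely for $k=1,\ldots,K-1$, if and only if it almost surely satisfies the variational equation $$\delta\mathcal{B}_d-\sum_{k=0}^{K-1}\Big(F^-_d(q_k,p_{k+1};t_k,t_{k+1})\,\delta q_k+F^+_d(q_k,p_{k+1};t_k,t_{k+1})\,\delta p_{k+1}\Big)=0$$ for all variations $\{(\delta q_k,\delta p_k)\}_{k=0,\ldots,K}$ such that $\delta q_0=0$ and $\delta p_K=0$ almost surely.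
   Context: Setting: $Q\cong\mathbb{R}^N$, $T^*Q\cong\mathbb{R}^N\times\mathbb{R}^N$; $(\Omega,\mathcal{F},\mathbb{P})$ is a probability space; $t_k=k\Delta t$, $k=0,\ldots,K$, $\Delta t=T/K$. For each pair $(t_k,t_{k+1})$, the discrete Hamiltonian $H^+_d(q,p;t_k,t_{k+1})$ is a random real-valued function and the discrete forces $F^\pm_d(q,p;t_k,t_{k+1})$ are random $\mathbb{R}^N$-valued functions of $(q,p)\in\mathbb{R}^N\times\mathbb{R}^N$ (dependence on $\omega\in\Omega$ suppressed). $D_1,D_2$ are derivatives with respect to the first ($q$) and second ($p$) arguments. Products of vectors denote scalar products. $C_d$ is the space of discrete random curves $\{(q_k,p_k)\}_{k=0,\ldots,K}$ where each $(q_k,p_k):\Omega\to T^*Q$ is a random variable; variations $\{(\delta q_k,\delta p_k)\}_{k=0,\ldots,K}$ are likewise elements of $C_d$. The discrete action functional $\mathcal{B}_d:\Omega\times C_d\to\mathbb{R}$ is $$\mathcal{B}_d\big[\{(q_k,p_k)\}\big]=p_Kq_K-\sum_{k=0}^{K-1}\big(p_{k+1}q_{k+1}-H^+_d(q_k,p_{k+1};t_k,t_{k+1})\big),$$ and $\delta\mathcal{B}_d=\frac{d}{d\epsilon}\big|_{\epsilon=0}\mathcal{B}_d\big[\{(q_k+\epsilon\,\delta q_k,\,p_k+\epsilon\,\delta p_k)\}\big]$. *)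

(* Defs.v *)
From HB Require Import structures.
From mathcomp Require Import all_boot all_order all_algebra.
From mathcomp Require Import all_classical all_reals all_analysis.

Set Implicit Arguments.
Unset Strict Implicit.
Unset Printing Implicit Defensive.

Import Order.TTheory GRing.Theory Num.Theory.
Import numFieldNormedType.Exports.

Local Open Scope classical_set_scope.
Local Open Scope ring_scope.

(* The phase space T^*Q, as pairs (q, p). *)
Notation phase R N := ('rV[R]_N * 'rV[R]_N)%type.

Definition dotv (R : realType) (N : nat) (u v : 'rV[R]_N) : R :=
  \sum_(i < N) u 0 i * v 0 i.

Definition grad (R : realType) (N : nat) (f : 'rV[R]_N -> R) (x : 'rV[R]_N) :
    'rV[R]_N :=
  \row_(i < N) 'D_(delta_mx 0 i) f x.

Definition D1 (R : realType) (N : nat) (h : phase R N -> R) (z : phase R N) :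
    'rV[R]_N :=
  grad (fun q => h (q, z.2)) z.1.

Definition D2 (R : realType) (N : nat) (h : phase R N -> R) (z : phase R N) :
    'rV[R]_N :=
  grad (fun p => h (z.1, p)) z.2.

(* The derivative of h at z is represented by (D1 h z, D2 h z), so its
   continuity in z is that of the two partial gradients. *)
Definition continuously_differentiable (R : realType) (N : nat)
    (h : phase R N -> R) : Prop :=
  [/\ forall z, differentiable h z, continuous (D1 h) & continuous (D2 h)].

(* Measurability with respect to the Borel sigma-algebra of E. *)
Definition borel_measurable (d : measure_display) (Omega : measurableType d)
    (E : topologicalType) (X : Omega -> E) : Prop :=
  forall A : set E, <<s @open E >> A -> measurable (X @^-1` A).

(* The space C_d. *)
Definition random_curve (d : measure_display) (Omega : measurableType d)
    (R : realType) (N K : nat) (c : 'I_K.+1 -> Omega -> phase R N) : Prop :=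
  forall k, borel_measurable (c k).

Definition grid (R : realType) (T : R) (K k : nat) : R := k%:R * (T / K%:R).

(* In H s t w z, the interval is (s, t) and w is the sample point. *)
Definition action (d : measure_display) (Omega : measurableType d)
    (R : realType) (N : nat) (T : R) (K : nat)
    (H : R -> R -> Omega -> phase R N -> R)
    (w : Omega) (c : 'I_K.+1 -> Omega -> phase R N) : R :=
  dotv (c ord_max w).2 (c ord_max w).1 -
  \sum_(0 <= k < K)
    (dotv (c (inord k.+1) w).2 (c (inord k.+1) w).1 -
     H (grid T K k) (grid T K k.+1) w
       ((c (inord k) w).1, (c (inord k.+1) w).2)).

Definition delta_action (d : measure_display) (Omega : measurableType d)
    (R : realType) (N : nat) (T : R) (K : nat)
    (H : R -> R -> Omega -> phase R N -> R)
    (w : Omega) (c dc : 'I_K.+1 -> Omega -> phase R N) : R :=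
  derive1 (fun eps : R => action T H w
     (fun k w' => ((c k w').1 + eps *: (dc k w').1,
                   (c k w').2 + eps *: (dc k w').2))) 0.

(* Main.v *)
(* Differentiating the action and summing by parts, the terms at k = 0 and k = K
   drop out because of the boundary conditions, and the forced variation equals
     sum_(1 <= k < K) (r^p_k . dq_k + r^q_k . dp_k),
   where r^q_k and r^p_k are the residuals of the two equations.  For the
   converse, deterministic variations supported at a single time and in a
   single coordinate suffice: each of them isolates one component of one residual, and
   there are finitely many. *)

Require Import Defs.
From HB Require Import structures.
From mathcomp Require Import all_boot all_order all_algebra.
From mathcomp Require Import all_classical all_reals all_analysis.
From mathcomp Require Import ring.

Set Implicit Arguments.
Unset Strict Implicit.
Unset Printing Implicit Defensive.

Import Order.TTheory GRing.Theory Num.Theory.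
Import numFieldNormedType.Exports.

Local Open Scope classical_set_scope.
Local Open Scope ring_scope.

(** * Algebra of the scalar product *)

Section Dotv.
Context (R : realType) (N : nat).
Implicit Types u v w : 'rV[R]_N.

Lemma dotvC u v : dotv u v = dotv v u.
Proof. by apply: eq_bigr => i _; rewrite mulrC. Qed.

Lemma dotv0r u : dotv u 0 = 0.
Proof. by apply: big1 => i _; rewrite mxE mulr0. Qed.

Lemma dotv0l u : dotv 0 u = 0.
Proof. by rewrite dotvC dotv0r. Qed.

Lemma dotvDl u v w : dotv (u + v) w = dotv u w + dotv v w.
Proof. by rewrite -big_split; apply: eq_bigr => i _; rewrite mxE mulrDl. Qed.

Lemma dotvNl u w : dotv (- u) w = - dotv u w.
Proof. by rewrite -sumrN; apply: eq_bigr => i _; rewrite mxE mulNr. Qed.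

Lemma dotvBl u v w : dotv (u - v) w = dotv u w - dotv v w.
Proof. by rewrite dotvDl dotvNl. Qed.

Lemma dotv_delta u (i : 'I_N) : dotv u (delta_mx 0 i) = u 0 i.
Proof.
rewrite /dotv (bigD1 i)//= mxE !eqxx mulr1 big1 ?addr0// => j ji.
by rewrite mxE (negbTE ji) andbF mulr0.
Qed.

End Dotv.

(** * Differentiation along lines in phase space *)

Section Derivatives.
Context (R : realType).

Lemma is_derive_sum_nat (n : nat) (f : nat -> R -> R) (df : nat -> R) (x : R) :
  (forall k, (k < n)%N -> is_derive x 1 (f k) (df k)) ->
  is_derive x 1 (fun e => \sum_(0 <= k < n) f k e) (\sum_(0 <= k < n) df k).
Proof.
move=> Df; rewrite big_mkord.
rewrite (_ : (fun e => _) = \sum_(k < n) f k); last first.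
  by apply/funext => e; rewrite big_mkord fct_sumE.
by apply: is_derive_sum => k; exact: Df.
Qed.

Lemma is_derive_affine (a u x : R) :
  is_derive x 1 (fun e : R => a + e * u) u.
Proof.
have -> : (fun e => a + e * u) = cst a + u *: (id : R -> R).
  by apply/funext => e; rewrite mulrC.
have := is_deriveD (is_derive_cst a x 1) (is_deriveZ u (is_derive_id x 1)).
by rewrite add0r [u *: 1]mulr1.
Qed.

Lemma is_derive_affineM (a u b v : R) :
  is_derive (0 : R) 1 (fun e : R => (a + e * u) * (b + e * v)) (u * b + a * v).
Proof.
have D := is_deriveM (is_derive_affine a u 0) (is_derive_affine b v 0).
apply: (is_derive_eq D).
by rewrite /= !mul0r !addr0 addrC; congr (_ + _); rewrite mulrC.
Qed.

Context (N : nat).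

Lemma is_derive_dotv (a b u v : 'rV[R]_N) :
  is_derive (0 : R) 1 (fun e : R => dotv (a + e *: u) (b + e *: v))
    (dotv u b + dotv a v).
Proof.
rewrite /dotv -big_split/=.
rewrite (_ : (fun e : R => _) = \sum_(i < N)
    (fun e : R => (a 0 i + e * u 0 i) * (b 0 i + e * v 0 i))); last first.
  by apply/funext => e; rewrite fct_sumE; apply: eq_bigr => i _; rewrite !mxE.
apply: is_derive_sum => i.
exact: is_derive_affineM.
Qed.

Lemma phase_lineE (e : R) (a b u v : 'rV[R]_N) :
  e *: (u, v) + (a, b) = (e *: u + a, e *: v + b) :> phase R N.
Proof. by []. Qed.

(** The differential is linear, so it is enough to know it on the basis vectors [(delta_mx 0 i, 0)];
    there it is a directional derivative that leaves the momentum fixed, hence an entry of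
    [D1 h z]. *)
Lemma diff_D1 (h : phase R N -> R) z u : differentiable h z ->
  'd h z (u, 0) = dotv (D1 h z) u.
Proof.
case: z => a b dh.
have -> : (u, 0) = \sum_(i < N) u 0 i *: (delta_mx 0 i, 0) :> phase R N.
  rewrite {1}[u]row_sum_delta [RHS]surjective_pairing.
  rewrite (raddf_sum fst) (raddf_sum snd)/=.
  by congr pair; rewrite big1// => i _; rewrite scaler0.
rewrite linear_sum; apply: eq_bigr => i _.
rewrite linearZ/= mulrC -deriveE// mxE; congr (_ * _).
(* Both derivatives are limits of difference quotients, which agree pointwise. *)
rewrite /derive; apply: (congr1 (fun F : R -> R => lim (F @ 0^'))).
by apply/funext => e /=; rewrite phase_lineE scaler0 add0r.
Qed.

Lemma diff_D2 (h : phase R N -> R) z u : differentiable h z ->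
  'd h z (0, u) = dotv (D2 h z) u.
Proof.
case: z => a b dh.
have -> : (0, u) = \sum_(i < N) u 0 i *: (0, delta_mx 0 i) :> phase R N.
  rewrite {1}[u]row_sum_delta [RHS]surjective_pairing.
  rewrite (raddf_sum fst) (raddf_sum snd)/=.
  by congr pair; rewrite big1// => i _; rewrite scaler0.
rewrite linear_sum; apply: eq_bigr => i _.
rewrite linearZ/= mulrC -deriveE// mxE; congr (_ * _).
rewrite /derive; apply: (congr1 (fun F : R -> R => lim (F @ 0^'))).
by apply/funext => e /=; rewrite phase_lineE scaler0 add0r.
Qed.

(** Chain rule along a line: the value is the directional derivative along [(u, v)], split by
    linearity of the differential over [(u, 0) + (0, v)]. *)
Lemma is_derive_phase_line (h : phase R N -> R) a b u v :
  differentiable h (a, b) ->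
  is_derive (0 : R) 1 (fun e : R => h (a + e *: u, b + e *: v))
    (dotv (D1 h (a, b)) u + dotv (D2 h (a, b)) v).
Proof.
move=> dh.
have -> : dotv (D1 h (a, b)) u + dotv (D2 h (a, b)) v = 'D_(u, v) h (a, b).
  rewrite deriveE// -diff_D1// -diff_D2// -linearD.
  have -> // : (u, 0) + (0, v) = (u, v) :> phase R N.
  by congr pair; rewrite /= ?addr0 ?add0r.
have -> : (fun e : R => h (a + e *: u, b + e *: v)) =
    (fun e : R => h (e *: (u, v) + (a, b))).
  by apply/funext => e; rewrite phase_lineE [a + _]addrC [b + _]addrC.
apply: DeriveDef.
  by apply: (derivable1P _ _ _).1; apply: diff_derivable; exact: dh.
rewrite /derive; apply: (congr1 (fun F : R -> R => lim (F @ 0^'))).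
apply/funext => e /=.
by rewrite addr0 [e *: 1]mulr1 scale0r add0r.
Qed.

End Derivatives.

(** Summation by parts: after the shift, the last [A] term cancels [A n] and the first [B] term is
    split off. For [n = 0] it would assert [A 0 = B 0]. *)
Lemma sumr_shiftB (V : zmodType) (A B : nat -> V) (n : nat) : (0 < n)%N ->
  A n - \sum_(0 <= k < n) (A k.+1 - B k) =
  B 0%N + \sum_(1 <= k < n) (B k - A k).
Proof.
move=> n_gt0; rewrite sumrB -(big_add1 _ _ 0 n.+1 xpredT) big_nat_recr//=.
rewrite [\sum_(0 <= k < n) B k]big_ltn// sumrB opprB opprD.
by rewrite addrCA [A n + _]addrC subrK addrA.
Qed.

(** * The forced variation of the discrete action *)

Section Variation.
Context (d : measure_display) (Omega : measurableType d) (R : realType).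
Context (N K : nat) (T : R) (H : R -> R -> Omega -> phase R N -> R).
Implicit Types (w : Omega) (c dc : 'I_K.+1 -> Omega -> phase R N) (k : nat).

Local Notation t := (grid T K).

Lemma delta_actionE w c dc :
  let q k := (c (inord k) w).1 in
  let p k := (c (inord k) w).2 in
  let dq k := (dc (inord k) w).1 in
  let dp k := (dc (inord k) w).2 in
  (forall k, (k < K)%N -> continuously_differentiable (H (t k) (t k.+1) w)) ->
  delta_action T H w c dc =
    dotv (dp K) (q K) + dotv (p K) (dq K) -
    \sum_(0 <= k < K)
      (dotv (dp k.+1) (q k.+1) + dotv (p k.+1) (dq k.+1) -
       (dotv (D1 (H (t k) (t k.+1) w) (q k, p k.+1)) (dq k) +
        dotv (D2 (H (t k) (t k.+1) w) (q k, p k.+1)) (dp k.+1))).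
Proof.
move=> q p dq dp HC1; rewrite /delta_action derive1E /action.
have <- : inord K = ord_max :> 'I_K.+1 by apply/val_inj; rewrite /= inordK.
apply: (@derive_val _ _ _ _ _ _ _ _).
apply: is_deriveB; first exact: is_derive_dotv.
apply: is_derive_sum_nat => k kK; apply: is_deriveB.
  exact: is_derive_dotv.
by apply: is_derive_phase_line; case: (HC1 k kK).
Qed.

(** The forces are not differentiated, so they enter only as fixed vectors [Gm k] and [Gp k], one
    pair for each interval. *)
Lemma forced_variationE w c dc (Gm Gp : nat -> 'rV[R]_N) :
  let q k := (c (inord k) w).1 in
  let p k := (c (inord k) w).2 in
  (0 < K)%N -> (dc ord0 w).1 = 0 -> (dc ord_max w).2 = 0 ->
  (forall k, (k < K)%N -> continuously_differentiable (H (t k) (t k.+1) w)) ->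
  delta_action T H w c dc -
    \sum_(0 <= k < K) (dotv (Gm k) (dc (inord k) w).1 +
                       dotv (Gp k) (dc (inord k.+1) w).2) =
  \sum_(1 <= k < K)
    (dotv (D1 (H (t k) (t k.+1) w) (q k, p k.+1) - Gm k - p k)
       (dc (inord k) w).1 +
     dotv (D2 (H (t k.-1) (t k) w) (q k.-1, p k) - Gp k.-1 - q k)
       (dc (inord k) w).2).
Proof.
move=> q p K_gt0 dq0 dpK HC1; rewrite delta_actionE//.
have E0 : inord 0 = ord0 :> 'I_K.+1 by apply/val_inj; rewrite /= inordK.
have EK : inord K = ord_max :> 'I_K.+1 by apply/val_inj; rewrite /= inordK.
rewrite -E0 in dq0; rewrite -EK in dpK.
(* The interval from [t k] to [t k.+1] contributes [A k.+1 - B k]: [A] gathers what is paired with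
   variations at its right end, [B] at its left end. The boundary conditions give [B 0 = 0] and
   reduce [A K] to the surviving endpoint term of the action. *)
pose A k := dotv (p k) (dc (inord k) w).1
  - dotv (D2 (H (t k.-1) (t k) w) (q k.-1, p k) - Gp k.-1 - q k)
         (dc (inord k) w).2.
pose B k := dotv (D1 (H (t k) (t k.+1) w) (q k, p k.+1) - Gm k)
  (dc (inord k) w).1.
have B0 : B 0%N = 0 by rewrite /B dq0 dotv0r.
have AK : A K = dotv (p K) (dc (inord K) w).1 by rewrite /A dpK dotv0r subr0.
rewrite -/(q K) -/(p K) dpK dotv0l add0r -AK -addrA -opprD -big_split/=.
rewrite (eq_bigr (fun k => A k.+1 - B k)); last first.
  move=> k _; rewrite /A /B !dotvBl [dotv (dc _ _).2 _]dotvC -/(q _) -/(p _).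
  by rewrite /=; ring.
rewrite sumr_shiftB// B0 add0r; apply: eq_bigr => k _.
by rewrite /A /B !dotvBl; ring.
Qed.

End Variation.

Section TestVariations.
Context (d : measure_display) (Omega : measurableType d).

Lemma borel_measurable_cst (E : topologicalType) (e : E) :
  borel_measurable (fun _ : Omega => e).
Proof. by move=> A _; rewrite preimage_cst; case: ifP. Qed.

(** Almost sure events are closed under finite intersection; this puts all times and all coordinates
    on one common event. *)
Lemma ae_forall_ord (R : realType) (mu : {measure set Omega -> \bar R}) n
    (Q : 'I_n -> Omega -> Prop) :
  (forall i, {ae mu, forall w, Q i w}) -> {ae mu, forall w, forall i, Q i w}.
Proof. by move=> ae_Q; exact: filter_forall. Qed.

Lemma ae_forall_lt (R : realType) (mu : {measure set Omega -> \bar R}) n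
    (Q : nat -> Omega -> Prop) :
  (forall k, (k < n)%N -> {ae mu, forall w, Q k w}) ->
  {ae mu, forall w, forall k, (k < n)%N -> Q k w}.
Proof.
move=> ae_Q; apply: (filterS _ (@ae_forall_ord _ mu n (fun k => Q k) _)).
  by move=> w Qw k kn; exact: (Qw (Ordinal kn)).
by move=> k; exact: ae_Q.
Qed.

End TestVariations.

Theorem theorem3p1 (d : measure_display) (Omega : measurableType d)
    (R : realType) (P : probability Omega R)
    (N K : nat) (T : R)
    (H : R -> R -> Omega -> phase R N -> R)
    (Fm Fp : R -> R -> Omega -> phase R N -> 'rV[R]_N)
    (K_gt0 : (0 < K)%N)
    (* H and F are random functions *)
    (H_meas : forall k, (k < K)%N -> forall z : phase R N,
       measurable_fun setT (fun w => H (grid T K k) (grid T K k.+1) w z))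
    (Fm_meas : forall k, (k < K)%N -> forall z : phase R N,
       borel_measurable (fun w => Fm (grid T K k) (grid T K k.+1) w z))
    (Fp_meas : forall k, (k < K)%N -> forall z : phase R N,
       borel_measurable (fun w => Fp (grid T K k) (grid T K k.+1) w z))
    (H_C1 : forall k, (k < K)%N ->
       {ae P, forall w,
          continuously_differentiable (H (grid T K k) (grid T K k.+1) w)})
    (Fm_cont : forall k, (k < K)%N ->
       {ae P, forall w, continuous (Fm (grid T K k) (grid T K k.+1) w)})
    (Fp_cont : forall k, (k < K)%N ->
       {ae P, forall w, continuous (Fp (grid T K k) (grid T K k.+1) w)})
    (c : 'I_K.+1 -> Omega -> phase R N)
    (c_curve : random_curve c) :
  let t := grid T K in
  let q (k : nat) (w : Omega) := (c (inord k) w).1 in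
  let p (k : nat) (w : Omega) := (c (inord k) w).2 in
  {ae P, forall w, forall k : nat, (1 <= k <= K.-1)%N ->
     q k w = D2 (H (t k.-1) (t k) w) (q k.-1 w, p k w)
             - Fp (t k.-1) (t k) w (q k.-1 w, p k w) /\
     p k w = D1 (H (t k) (t k.+1) w) (q k w, p k.+1 w)
             - Fm (t k) (t k.+1) w (q k w, p k.+1 w)}
  <->
  (forall dc : 'I_K.+1 -> Omega -> phase R N,
     random_curve dc ->
     {ae P, forall w, (dc ord0 w).1 = 0} ->
     {ae P, forall w, (dc ord_max w).2 = 0} ->
     {ae P, forall w,
        delta_action T H w c dc -
        \sum_(0 <= k < K)
          (dotv (Fm (t k) (t k.+1) w (q k w, p k.+1 w)) (dc (inord k) w).1 +
           dotv (Fp (t k) (t k.+1) w (q k w, p k.+1 w))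
                (dc (inord k.+1) w).2) = 0}).
Proof.
move=> t q p.
have HC1 := ae_forall_lt H_C1.
(* Residuals of the two equations. The one for [q] is paired with variations of [p], and
   conversely. *)
pose rq k w := D2 (H (t k.-1) (t k) w) (q k.-1 w, p k w)
  - Fp (t k.-1) (t k) w (q k.-1 w, p k w) - q k w.
pose rp k w := D1 (H (t k) (t k.+1) w) (q k w, p k.+1 w)
  - Fm (t k) (t k.+1) w (q k w, p k.+1 w) - p k w.
have variationE w (dc : 'I_K.+1 -> Omega -> phase R N) :
    (forall k, (k < K)%N -> continuously_differentiable (H (t k) (t k.+1) w)) ->
    (dc ord0 w).1 = 0 -> (dc ord_max w).2 = 0 ->
    delta_action T H w c dc -
        \sum_(0 <= k < K)
          (dotv (Fm (t k) (t k.+1) w (q k w, p k.+1 w)) (dc (inord k) w).1 +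
           dotv (Fp (t k) (t k.+1) w (q k w, p k.+1 w))
                (dc (inord k.+1) w).2) =
    \sum_(1 <= k < K) (dotv (rp k w) (dc (inord k) w).1 +
                       dotv (rq k w) (dc (inord k) w).2).
  move=> HC dq0 dpK.
  rewrite (@forced_variationE _ _ _ _ _ T H w c dc
    (fun k => Fm (t k) (t k.+1) w (q k w, p k.+1 w))
    (fun k => Fp (t k) (t k.+1) w (q k w, p k.+1 w)))//.
  (* The sum starts at 1, so the index is a successor and [k.-1.+1] reduces to [k]. *)
  by apply: eq_big_nat => -[|k].
split=> [eqs dc _ dq0 dpK|var].
  near=> w; rewrite variationE; [|by near: w..].
  have eqs_w : forall k, (1 <= k <= K.-1)%N ->
    q k w = D2 (H (t k.-1) (t k) w) (q k.-1 w, p k w)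
             - Fp (t k.-1) (t k) w (q k.-1 w, p k w) /\
     p k w = D1 (H (t k) (t k.+1) w) (q k w, p k.+1 w)
             - Fm (t k) (t k.+1) w (q k w, p k.+1 w) by near: w.
  rewrite big_nat big1// => k /andP[k_gt0 kK].
  have [|qk pk] := eqs_w k; first by rewrite k_gt0 -ltnS prednK.
  by rewrite /rp /rq -pk -qk !subrr !dotv0l addr0.
(* Not depending on the sample point, it is measurable; for [0 < k < K] it vanishes at both ends, so
   it is an admissible variation. *)
pose test (k : nat) (z : phase R N) (j : 'I_K.+1) (_ : Omega) : phase R N :=
  if j == k :> nat then z else 0.
have varE k z : (0 < k < K)%N ->
    {ae P, forall w, dotv (rp k w) z.1 + dotv (rq k w) z.2 = 0}.
  move=> /andP[k_gt0 kK].
  have t0 w : test k z ord0 w = 0 by rewrite /test /= ltn_eqF.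
  have tK w : test k z ord_max w = 0 by rewrite /test /= gtn_eqF.
  have test_curve : random_curve (test k z).
    by move=> j; exact: borel_measurable_cst.
  have := var _ test_curve
    (aeW _ (fun w => congr1 fst (t0 w))) (aeW _ (fun w => congr1 snd (tK w))).
  apply: filterS2 HC1 => w HC; rewrite variationE ?t0 ?tK// => <-.
  (* Only the summand at time [k] survives. *)
  rewrite (bigD1_seq k)/= ?iota_uniq ?mem_index_iota ?k_gt0//.
  rewrite /test inordK ?eqxx ?(ltnW kK)//; last exact: ltnW.
  rewrite big_seq_cond big1 ?addr0// => j.
  rewrite mem_index_iota => /andP[/andP[j_gt0 jK] jk].
  by rewrite inordK ?(negbTE jk) ?dotv0r ?addr0// ltnW.
have rq0 k : (0 < k < K)%N -> {ae P, forall w, rq k w = 0}.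
  (* Taking [z] to be a basis vector in the momentum slot reads off one coordinate of [rq]; the [N]
     exceptional null sets are then merged. *)
  move=> kK; have := @ae_forall_ord _ _ _ P N _
    (fun i => varE k (0, delta_mx 0 i) kK).
  apply: filterS => w rqw; apply/rowP => i.
  by have := rqw i; rewrite /= dotv0r add0r dotv_delta => ->; rewrite mxE.
have rp0 k : (0 < k < K)%N -> {ae P, forall w, rp k w = 0}.
  move=> kK; have := @ae_forall_ord _ _ _ P N _
    (fun i => varE k (delta_mx 0 i, 0) kK).
  apply: filterS => w rpw; apply/rowP => i.
  by have := rpw i; rewrite /= dotv0r addr0 dotv_delta => ->; rewrite mxE.
(* Needed to turn the bound [k <= K.-1] of the statement into [k < K]. *)
have [n Kn] : exists n, K = n.+1 by case: (K) K_gt0 => // n; exists n.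
have : {ae P, forall w, forall k, (k < K)%N -> (0 < k)%N ->
    rq k w = 0 /\ rp k w = 0}.
  apply: ae_forall_lt => k kK; case: (posnP k) => [->|k_gt0].
    exact: aeW.
  have k_in : (0 < k < K)%N by rewrite k_gt0.
  by apply: filterS2 (rq0 k k_in) (rp0 k k_in) => w.
apply: filterS => w r0 k /andP[k_gt0 kK].
have [||rqk rpk] := r0 k; [by rewrite Kn in kK *|by []|].
by split; apply/esym/subr0_eq.
Unshelve. all: by end_near. Qed.
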